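(* Let $K$ be a field with $\mathrm{char}(K)\neq 2$, let $m\geq 1$, and let $\mathfrak{n}_{m,2}$ be the free nilpotent Lie algebra over $K$ of rank $m$ and class $2$. Then $$\dim R(\mathfrak{n}_{m,2})=\frac{1}{24}\left(3m^4-2m^3-15m^2+14m\right).$$
   Context: For a Lie algebra $\mathfrak{g}$ over $K$, let $\mathfrak{g}^{\psi}$ be an isomorphic copy of $\mathfrak{g}$ via $x\mapsto x^{\psi}$, and let $\chi(\mathfrak{g})=\langle \mathfrak{g},\mathfrak{g}^{\psi} \mid [x,x^{\psi}]=0 \text{ for all } x\in\mathfrak{g}\rangle$ (the quotient of the free product of the Lie algebras $\mathfrak{g}$ and $\mathfrak{g}^{\psi}$ by the ideal generated by all $[x,x^{\psi}]$). Let $\alpha:\chi(\mathfrak{g})\to\mathfrak{g}$ be the homomorphism with $\alpha(x)=\alpha(x^{\psi})=x$ for all $x\in\mathfrak{g}$, and $L=L(\mathfrak{g})=\ker(\alpha)$. Define $R(\mathfrak{g})=[\mathfrak{g},[L,\mathfrak{g}^{\psi}]]$, an ideal of $\chi(\mathfrak{g})$, where brackets of subspaces denote linear spans of brackets of their elements. Here $\mathfrak{n}_{m,2}=F/\gamma_{3}(F)$ with $F$ free of rank $m$ and $\gamma_3(F)=[F,[F,F]]$. *)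

(* Defs.v *)
From HB Require Import structures.
From mathcomp Require Import all_boot all_order all_algebra.
From mathcomp Require Import boolp classical_sets.

Set Implicit Arguments.
Unset Strict Implicit.
Unset Printing Implicit Defensive.

Import GRing.Theory.
Local Open Scope ring_scope.
Local Open Scope quotient_scope.
Local Open Scope classical_set_scope.

(* Lie algebras of arbitrary, possibly infinite, dimension. The axiom
   [x, x] = 0 is required, not merely antisymmetry. *)
HB.mixin Record Lmodule_isLie (K : fieldType) L of GRing.Lmodule K L := {
  bracket : L -> L -> L;
  bracket_linearl : forall z, linear (fun x => bracket x z);
  bracket_linearr : forall z, linear (bracket z);
  bracketxx : forall x, bracket x x = 0;
  jacobi : forall x y z,
    bracket x (bracket y z) + bracket y (bracket z x)
    + bracket z (bracket x y) = 0
}.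

#[short(type="lieType")]
HB.structure Definition Lie (K : fieldType) :=
  { L of GRing.Lmodule K L & Lmodule_isLie K L }.

Definition lie_hom (K : fieldType) (L M : lieType K) (f : L -> M) : Prop :=
  linear f /\ {morph f : x y / bracket x y}.

Section Subspaces.
Variables (K : fieldType) (V : lmodType K).

Definition subspace (S : set V) : Prop :=
  S 0 /\ forall (a : K) (u v : V), S u -> S v -> S (a *: u + v).

Definition lspan (A : set V) : set V := smallest subspace A.

Lemma lspan_subspace (A : set V) : subspace (lspan A).
Proof.
split=> [M [[M0 _] _] // | a u v Au Av M [Ms AM]].
by apply: (Ms.2); [apply: Au | apply: Av].
Qed.

Definition has_dim (S : set V) (d : nat) : Prop :=
  exists b : 'I_d -> V,
    (forall c : 'I_d -> K, \sum_i c i *: b i = 0 -> forall i, c i = 0) /\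
    S = [set v | exists c : 'I_d -> K, v = \sum_i c i *: b i].

End Subspaces.

Section Brackets.
Variables (K : fieldType) (L : lieType K).
Implicit Types x y z : L.

Lemma bracketDl x y z : bracket (x + y) z = bracket x z + bracket y z.
Proof. by have := bracket_linearl z 1 x y; rewrite !scale1r. Qed.

Lemma bracketDr x y z : bracket z (x + y) = bracket z x + bracket z y.
Proof. by have := bracket_linearr z 1 x y; rewrite !scale1r. Qed.

Lemma bracket0l x : bracket 0 x = 0.
Proof. by apply: (addrI (bracket 0 x)); rewrite -bracketDl !addr0. Qed.

Lemma bracket0r x : bracket x 0 = 0.
Proof. by apply: (addrI (bracket x 0)); rewrite -bracketDr !addr0. Qed.

Lemma bracketNl x y : bracket (- x) y = - bracket x y.
Proof. by apply: (addrI (bracket x y)); rewrite -bracketDl !subrr bracket0l. Qed.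

Lemma bracketNr x y : bracket x (- y) = - bracket x y.
Proof. by apply: (addrI (bracket x y)); rewrite -bracketDr !subrr bracket0r. Qed.

Lemma bracketC x y : bracket x y = - bracket y x.
Proof.
apply/eqP; rewrite -addr_eq0; apply/eqP.
have := bracketxx (x + y); rewrite bracketDl !bracketDr !bracketxx.
by rewrite add0r addr0.
Qed.

Definition lie_comm (A B : set L) : set L :=
  lspan [set bracket a b | a in A & b in B].

Definition lie_ideal_closed (I : set L) : Prop :=
  subspace I /\ forall x y, I y -> I (bracket x y).

Definition ideal_gen (A : set L) : set L := smallest lie_ideal_closed A.

Lemma ideal_gen_closed (A : set L) : lie_ideal_closed (ideal_gen A).
Proof.
split; first split.
- by move=> M [[[]]].
- move=> a u v Au Av M [MI AM].
  by apply: (MI.1.2); [apply: Au | apply: Av].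
- by move=> x y Ay M [MI AM]; apply: (MI.2); apply: Ay.
Qed.

Definition gamma3 : set L := lie_comm setT (lie_comm setT setT).

Lemma gamma3_closed : lie_ideal_closed gamma3.
Proof.
split=> [|x y gy]; first exact: lspan_subspace.
apply: sub_gen_smallest; exists x => //; exists y => //.
apply: gy; split; first exact: lspan_subspace.
move=> _ [a _ [b _ <-]]; apply: sub_gen_smallest.
by exists a => //; exists b.
Qed.

End Brackets.

Record lie_ideal (K : fieldType) (L : lieType K) := LieIdeal {
  ideal_set :> L -> Prop;
  ideal_setP : lie_ideal_closed ideal_set
}.

Section Quotient.
Variables (K : fieldType) (L : lieType K) (I : lie_ideal L).

Definition ideal_pred : {pred L} := fun x => `[< I x >].

Lemma ideal_zmod_closed : zmod_closed ideal_pred.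
Proof.
have [[I0 IZ] _] := ideal_setP I.
split=> [|x y /asboolP Ix /asboolP Iy]; apply/asboolP => //.
by rewrite addrC -scaleN1r; apply: IZ.
Qed.

HB.instance Definition _ := GRing.isZmodClosed.Build L ideal_pred
  ideal_zmod_closed.

Definition lie_quot : Type := Quotient.quot ideal_pred.

HB.instance Definition _ := GRing.Zmodule.on lie_quot.

Definition lie_proj (x : L) : lie_quot := \pi_(Quotient.quot ideal_pred) x.
Definition lie_rep (u : lie_quot) : L := repr (u : Quotient.quot ideal_pred).

Lemma lie_repK : cancel lie_rep lie_proj.
Proof. by move=> u; apply: reprK. Qed.

Lemma lie_projP x y : lie_proj x = lie_proj y <-> I (x - y).
Proof.
split=> [/eqP | Ixy].
  by rewrite /lie_proj -Quotient.idealrBE => /asboolP.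
by apply/eqP; rewrite /lie_proj -Quotient.idealrBE; apply/asboolP.
Qed.

Lemma lie_projD x y : lie_proj (x + y) = lie_proj x + lie_proj y.
Proof. exact: (@raddfD _ _ (\pi_(Quotient.quot ideal_pred))). Qed.

Lemma idealP_rep x : I (lie_rep (lie_proj x) - x).
Proof. by apply/lie_projP; rewrite lie_repK. Qed.

Definition quot_scale (a : K) (u : lie_quot) : lie_quot :=
  lie_proj (a *: lie_rep u).

Lemma quot_scaleE a x : quot_scale a (lie_proj x) = lie_proj (a *: x).
Proof.
apply/lie_projP; rewrite -scalerBr.
have [[I0 IZ] _] := ideal_setP I.
by rewrite -[_ *: _]addr0; apply: IZ => //; apply: idealP_rep.
Qed.

Lemma quot_scaleA a b u :
  quot_scale a (quot_scale b u) = quot_scale (a * b) u.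
Proof. by rewrite -[u]lie_repK !quot_scaleE scalerA. Qed.

Lemma quot_scale1 : left_id 1 quot_scale.
Proof. by move=> u; rewrite -[u]lie_repK quot_scaleE scale1r. Qed.

Lemma quot_scaleDr : right_distributive quot_scale +%R.
Proof.
move=> a u v; rewrite -[u]lie_repK -[v]lie_repK -lie_projD !quot_scaleE.
by rewrite scalerDr lie_projD.
Qed.

Lemma quot_scaleDl u : {morph quot_scale^~ u : a b / a + b}.
Proof.
by move=> a b; rewrite -[u]lie_repK !quot_scaleE scalerDl lie_projD.
Qed.

HB.instance Definition _ := GRing.Zmodule_isLmodule.Build K lie_quot
  quot_scaleA quot_scale1 quot_scaleDr quot_scaleDl.

Lemma lie_projZ a x : lie_proj (a *: x) = a *: lie_proj x.
Proof. by rewrite -quot_scaleE. Qed.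

Definition quot_bracket (u v : lie_quot) : lie_quot :=
  lie_proj (bracket (lie_rep u) (lie_rep v)).

Lemma quot_bracketE x y :
  quot_bracket (lie_proj x) (lie_proj y) = lie_proj (bracket x y).
Proof.
have [[I0 IZ] IB] := ideal_setP I.
set x' := lie_rep (lie_proj x); set y' := lie_rep (lie_proj y).
have Bx : I (bracket (x' - x) y').
  rewrite bracketC -[- _]addr0 -scaleN1r; apply: IZ => //.
  by apply: IB; apply: idealP_rep.
have By : I (bracket x (y' - y)) by apply: IB; apply: idealP_rep.
apply/lie_projP.
have := IZ 1 _ _ Bx By; rewrite scale1r !(bracketDl, bracketDr).
by rewrite bracketNl bracketNr addrA subrK.
Qed.

Lemma quot_bracket_linearl w : linear (fun u => quot_bracket u w).
Proof.
move=> a u v; rewrite -[u]lie_repK -[v]lie_repK -[w]lie_repK.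
by rewrite -lie_projZ -lie_projD !quot_bracketE bracket_linearl
           lie_projD lie_projZ.
Qed.

Lemma quot_bracket_linearr w : linear (quot_bracket w).
Proof.
move=> a u v; rewrite -[u]lie_repK -[v]lie_repK -[w]lie_repK.
by rewrite -lie_projZ -lie_projD !quot_bracketE bracket_linearr
           lie_projD lie_projZ.
Qed.

Lemma lie_proj0 : lie_proj 0 = 0.
Proof. by apply: (addrI (lie_proj 0)); rewrite -lie_projD !addr0. Qed.

Lemma quot_bracketxx u : quot_bracket u u = 0.
Proof. by rewrite -[u]lie_repK quot_bracketE bracketxx lie_proj0. Qed.

Lemma quot_jacobi u v w :
  quot_bracket u (quot_bracket v w) + quot_bracket v (quot_bracket w u)
  + quot_bracket w (quot_bracket u v) = 0.
Proof.
rewrite -[u]lie_repK -[v]lie_repK -[w]lie_repK !quot_bracketE -!lie_projD.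
by rewrite jacobi lie_proj0.
Qed.

HB.instance Definition _ := Lmodule_isLie.Build K lie_quot
  quot_bracket_linearl quot_bracket_linearr quot_bracketxx quot_jacobi.

Lemma lie_proj_hom : lie_hom lie_proj.
Proof.
split=> [a x y | x y]; first by rewrite lie_projD lie_projZ.
by rewrite -quot_bracketE.
Qed.

(* The map induced by f; meaningful when f vanishes on I. *)
Definition quot_lift (M : lieType K) (f : L -> M) (u : lie_quot) : M :=
  f (lie_rep u).

Lemma quot_liftE (M : lieType K) (f : L -> M) :
  lie_hom f -> (forall x, I x -> f x = 0) ->
  forall x, quot_lift f (lie_proj x) = f x.
Proof.
move=> [flin _] fI x; have := fI _ (idealP_rep x).
have fB y z : f (y - z) = f y - f z.
  by rewrite addrC -scaleN1r flin scaleN1r addrC.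
by rewrite fB => /eqP; rewrite subr_eq0 => /eqP.
Qed.

Lemma quot_lift_hom (M : lieType K) (f : L -> M) :
  lie_hom f -> (forall x, I x -> f x = 0) -> lie_hom (quot_lift f).
Proof.
move=> fh fI; have fE := quot_liftE fh fI.
split=> [a u v | u v]; rewrite -[u]lie_repK -[v]lie_repK.
  by rewrite -lie_projZ -lie_projD !fE fh.1.
by rewrite -[bracket (lie_proj _) _]/(quot_bracket _ _) quot_bracketE !fE fh.2.
Qed.

End Quotient.

Lemma lie_hom0 (K : fieldType) (L M : lieType K) (f : L -> M) :
  lie_hom f -> f 0 = 0.
Proof.
move=> [flin _]; have := flin 1 0 0; rewrite !scale1r !addr0 => f00.
by apply: (addrI (f 0)); rewrite addr0 -f00.
Qed.

Lemma ideal_gen_kill (K : fieldType) (L M : lieType K) (A : set L)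
    (f : L -> M) :
  lie_hom f -> (forall x, A x -> f x = 0) ->
  forall x, ideal_gen A x -> f x = 0.
Proof.
move=> fh fA; apply: (@smallest_sub _ _ _ [set x | f x = 0]) => //.
split; first split.
- exact: lie_hom0 fh.
- by move=> a u v /= fu fv; rewrite fh.1 fu fv scaler0 addr0.
- by move=> x y /= fy; rewrite fh.2 fy bracket0r.
Qed.

(* The free Lie algebra on X: formal Lie expressions in the elements of X,
   modulo the congruence generated by the axioms of Lie algebras. *)
Inductive lie_term (K : fieldType) (X : Type) : Type :=
| Gen of X
| Zero
| Add of lie_term K X & lie_term K X
| Scale of K & lie_term K X
| Br of lie_term K X & lie_term K X.

Arguments Gen {K X}.
Arguments Zero {K X}.

Inductive lie_eqv (K : fieldType) (X : Type) :
    lie_term K X -> lie_term K X -> Prop :=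
| eqv_refl s : lie_eqv s s
| eqv_sym s t : lie_eqv s t -> lie_eqv t s
| eqv_trans s t u : lie_eqv s t -> lie_eqv t u -> lie_eqv s u
| eqv_Add s s' t t' :
    lie_eqv s s' -> lie_eqv t t' -> lie_eqv (Add s t) (Add s' t')
| eqv_Scale a s s' : lie_eqv s s' -> lie_eqv (Scale a s) (Scale a s')
| eqv_Br s s' t t' :
    lie_eqv s s' -> lie_eqv t t' -> lie_eqv (Br s t) (Br s' t')
| eqv_addA s t u : lie_eqv (Add s (Add t u)) (Add (Add s t) u)
| eqv_addC s t : lie_eqv (Add s t) (Add t s)
| eqv_add0 s : lie_eqv (Add Zero s) s
| eqv_addN s : lie_eqv (Add (Scale (-1) s) s) Zero
| eqv_scaleA a b s : lie_eqv (Scale a (Scale b s)) (Scale (a * b) s)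
| eqv_scale1 s : lie_eqv (Scale 1 s) s
| eqv_scaleDr a s t : lie_eqv (Scale a (Add s t)) (Add (Scale a s) (Scale a t))
| eqv_scaleDl a b s : lie_eqv (Scale (a + b) s) (Add (Scale a s) (Scale b s))
| eqv_brl a s t u :
    lie_eqv (Br (Add (Scale a s) t) u) (Add (Scale a (Br s u)) (Br t u))
| eqv_brr a s t u :
    lie_eqv (Br u (Add (Scale a s) t)) (Add (Scale a (Br u s)) (Br u t))
| eqv_brxx s : lie_eqv (Br s s) Zero
| eqv_jacobi s t u :
    lie_eqv (Add (Add (Br s (Br t u)) (Br t (Br u s))) (Br u (Br s t))) Zero.

Section FreeLie.
Variables (K : fieldType) (X : Type).

HB.instance Definition _ := gen_eqMixin (lie_term K X).
HB.instance Definition _ := gen_choiceMixin (lie_term K X).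

Definition term_eqv (s t : lie_term K X) : bool := `[< lie_eqv s t >].

Lemma term_eqv_equiv : equiv_class_of term_eqv.
Proof.
split=> [s | s t | t s u].
- by apply/asboolP; apply: eqv_refl.
- by apply/asboolP/asboolP; apply: eqv_sym.
- by move=> /asboolP st /asboolP tu; apply/asboolP; apply: eqv_trans st tu.
Qed.

Canonical term_eqv_equivRel := EquivRelPack term_eqv_equiv.
Canonical term_eqv_encModRel := defaultEncModRel term_eqv.

Definition free_lie : Type := {eq_quot term_eqv}.

HB.instance Definition _ := Choice.copy free_lie {eq_quot term_eqv}.

Definition free_class (s : lie_term K X) : free_lie := \pi_{eq_quot term_eqv} s.
Definition free_repr (u : free_lie) : lie_term K X :=
  repr (u : {eq_quot term_eqv}).

Lemma free_reprK : cancel free_repr free_class.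
Proof. by move=> u; apply: reprK. Qed.

Lemma free_classP s t : free_class s = free_class t <-> lie_eqv s t.
Proof.
split=> [/eqmodP /asboolP // | st].
by apply/eqmodP/asboolP.
Qed.

Lemma free_repr_eqv s : lie_eqv (free_repr (free_class s)) s.
Proof. by apply/free_classP; rewrite free_reprK. Qed.

Definition free_gen (x : X) : free_lie := free_class (Gen x).
Definition free_zero : free_lie := free_class Zero.
Definition free_add (u v : free_lie) : free_lie :=
  free_class (Add (free_repr u) (free_repr v)).
Definition free_scale (a : K) (u : free_lie) : free_lie :=
  free_class (Scale a (free_repr u)).
Definition free_opp (u : free_lie) : free_lie := free_scale (-1) u.
Definition free_bracket (u v : free_lie) : free_lie :=
  free_class (Br (free_repr u) (free_repr v)).

Lemma free_addE s t :
  free_add (free_class s) (free_class t) = free_class (Add s t).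
Proof. by apply/free_classP; apply: eqv_Add; apply: free_repr_eqv. Qed.

Lemma free_scaleE a s : free_scale a (free_class s) = free_class (Scale a s).
Proof. by apply/free_classP; apply: eqv_Scale; apply: free_repr_eqv. Qed.

Lemma free_bracketE s t :
  free_bracket (free_class s) (free_class t) = free_class (Br s t).
Proof. by apply/free_classP; apply: eqv_Br; apply: free_repr_eqv. Qed.

Let freeE := (free_addE, free_scaleE, free_bracketE).

Lemma free_addA : associative free_add.
Proof.
move=> u v w; rewrite -[u]free_reprK -[v]free_reprK -[w]free_reprK !freeE.
by apply/free_classP; apply: eqv_addA.
Qed.

Lemma free_addC : commutative free_add.
Proof.
move=> u v; rewrite -[u]free_reprK -[v]free_reprK !freeE.
by apply/free_classP; apply: eqv_addC.
Qed.

Lemma free_add0 : left_id free_zero free_add.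
Proof.
move=> u; rewrite -[u]free_reprK freeE.
by apply/free_classP; apply: eqv_add0.
Qed.

Lemma free_addN : left_inverse free_zero free_opp free_add.
Proof.
move=> u; rewrite -[u]free_reprK /free_opp !freeE.
by apply/free_classP; apply: eqv_addN.
Qed.

HB.instance Definition _ := GRing.isZmodule.Build free_lie
  free_addA free_addC free_add0 free_addN.

Lemma free_scaleA a b u : free_scale a (free_scale b u) = free_scale (a * b) u.
Proof.
rewrite -[u]free_reprK !freeE.
by apply/free_classP; apply: eqv_scaleA.
Qed.

Lemma free_scale1 : left_id 1 free_scale.
Proof.
move=> u; rewrite -[u]free_reprK !freeE.
by apply/free_classP; apply: eqv_scale1.
Qed.

Lemma free_scaleDr : right_distributive free_scale +%R.
Proof.
move=> a u v; rewrite /GRing.add /= -[u]free_reprK -[v]free_reprK !freeE.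
by apply/free_classP; apply: eqv_scaleDr.
Qed.

Lemma free_scaleDl u : {morph free_scale^~ u : a b / a + b}.
Proof.
move=> a b; rewrite -[u]free_reprK {2}/GRing.add /= !freeE.
by apply/free_classP; apply: eqv_scaleDl.
Qed.

HB.instance Definition _ := GRing.Zmodule_isLmodule.Build K free_lie
  free_scaleA free_scale1 free_scaleDr free_scaleDl.

Lemma free_classD s t : free_class (Add s t) = free_class s + free_class t.
Proof. by rewrite -free_addE. Qed.

Lemma free_classZ a s : free_class (Scale a s) = a *: free_class s.
Proof. by rewrite -free_scaleE. Qed.

Lemma free_bracket_linearl w : linear (fun u => free_bracket u w).
Proof.
move=> a u v; rewrite -[u]free_reprK -[v]free_reprK -[w]free_reprK.
rewrite -free_classZ -free_classD !freeE -free_classZ -free_classD.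
by apply/free_classP; apply: eqv_brl.
Qed.

Lemma free_bracket_linearr w : linear (free_bracket w).
Proof.
move=> a u v; rewrite -[u]free_reprK -[v]free_reprK -[w]free_reprK.
rewrite -free_classZ -free_classD !freeE -free_classZ -free_classD.
by apply/free_classP; apply: eqv_brr.
Qed.

Lemma free_bracketxx u : free_bracket u u = 0.
Proof.
rewrite -[u]free_reprK freeE.
by apply/free_classP; apply: eqv_brxx.
Qed.

Lemma free_jacobi u v w :
  free_bracket u (free_bracket v w) + free_bracket v (free_bracket w u)
  + free_bracket w (free_bracket u v) = 0.
Proof.
rewrite -[u]free_reprK -[v]free_reprK -[w]free_reprK !freeE -!free_classD.
by apply/free_classP; apply: eqv_jacobi.
Qed.

HB.instance Definition _ := Lmodule_isLie.Build K free_lie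
  free_bracket_linearl free_bracket_linearr free_bracketxx free_jacobi.

Variables (M : lieType K) (f : X -> M).

Fixpoint term_eval (s : lie_term K X) : M :=
  match s with
  | Gen x => f x
  | Zero => 0
  | Add s t => term_eval s + term_eval t
  | Scale a s => a *: term_eval s
  | Br s t => bracket (term_eval s) (term_eval t)
  end.

Definition free_lift (u : free_lie) : M := term_eval (free_repr u).

Lemma term_eval_eqv s t : lie_eqv s t -> term_eval s = term_eval t.
Proof.
elim=> //= {s t}.
- by move=> s t u _ -> _ ->.
- by move=> s s' t t' _ -> _ ->.
- by move=> a s s' _ ->.
- by move=> s s' t t' _ -> _ ->.
- by move=> *; rewrite addrA.
- by move=> *; rewrite addrC.
- by move=> *; rewrite add0r.
- by move=> *; rewrite scaleN1r addNr.
- by move=> *; rewrite scalerA.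
- by move=> *; rewrite scale1r.
- by move=> *; rewrite scalerDr.
- by move=> *; rewrite scalerDl.
- by move=> *; rewrite bracket_linearl.
- by move=> *; rewrite bracket_linearr.
- by move=> *; rewrite bracketxx.
- by move=> *; rewrite jacobi.
Qed.

Lemma free_lift_class s : free_lift (free_class s) = term_eval s.
Proof. by apply: term_eval_eqv; apply: free_repr_eqv. Qed.

Lemma free_lift_gen x : free_lift (free_gen x) = f x.
Proof. exact: free_lift_class. Qed.

Lemma free_lift_hom : lie_hom free_lift.
Proof.
split=> [a u v | u v]; rewrite -[u]free_reprK -[v]free_reprK.
  by rewrite -free_classZ -free_classD !free_lift_class.
rewrite -[bracket (free_class _) _]/(free_bracket _ _) free_bracketE.
by rewrite !free_lift_class.
Qed.

Lemma free_lift_unique (h : free_lie -> M) :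
  lie_hom h -> (forall x, h (free_gen x) = f x) -> h =1 free_lift.
Proof.
move=> hh hf u; rewrite -[u]free_reprK free_lift_class.
elim: (free_repr u) => //= [|s IHs t IHt|a s IHs|s IHs t IHt].
- exact: lie_hom0 hh.
- by rewrite free_classD -[free_class s]scale1r hh.1 scale1r IHs IHt.
- by rewrite free_classZ -[_ *: _]addr0 hh.1 lie_hom0 // addr0 IHs.
- by rewrite -free_bracketE -IHs -IHt -hh.2.
Qed.

End FreeLie.

Arguments free_gen {K X}.

Section FreeProduct.
Variables (K : fieldType) (g h : lieType K).

(* The free product is presented by the generators g + h and the relations
   making both inclusions homomorphisms of Lie algebras. *)
Definition free_prod_rel : set (free_lie K (g + h)) :=
  [set r | [\/ exists a x y, r = free_gen (inl (a *: x + y))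
                 - (a *: free_gen (inl x) + free_gen (inl y)),
               exists x y, r = free_gen (inl (bracket x y))
                 - bracket (free_gen (inl x)) (free_gen (inl y)),
               exists a x y, r = free_gen (inr (a *: x + y))
                 - (a *: free_gen (inr x) + free_gen (inr y)) |
               exists x y, r = free_gen (inr (bracket x y))
                 - bracket (free_gen (inr x)) (free_gen (inr y))]].

Definition free_prod : lieType K :=
  lie_quot (LieIdeal (ideal_gen_closed free_prod_rel)).

Definition free_prod_inl (x : g) : free_prod := lie_proj _ (free_gen (inl x)).
Definition free_prod_inr (x : h) : free_prod := lie_proj _ (free_gen (inr x)).

Lemma free_prod_inl_hom : lie_hom free_prod_inl.
Proof.
have [plin pbr] := lie_proj_hom (LieIdeal (ideal_gen_closed free_prod_rel)).
split=> [a x y | x y]; rewrite /free_prod_inl -?plin -?pbr.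
  apply/lie_projP; apply: sub_gen_smallest.
  by apply: Or41; exists a, x, y.
by apply/lie_projP; apply: sub_gen_smallest; apply: Or42; exists x, y.
Qed.

Lemma free_prod_inr_hom : lie_hom free_prod_inr.
Proof.
have [plin pbr] := lie_proj_hom (LieIdeal (ideal_gen_closed free_prod_rel)).
split=> [a x y | x y]; rewrite /free_prod_inr -?plin -?pbr.
  apply/lie_projP; apply: sub_gen_smallest.
  by apply: Or43; exists a, x, y.
by apply/lie_projP; apply: sub_gen_smallest; apply: Or44; exists x, y.
Qed.

Variables (M : lieType K) (f1 : g -> M) (f2 : h -> M).

Definition sum_fun (s : g + h) : M :=
  match s with inl x => f1 x | inr y => f2 y end.

Definition free_prod_lift : free_prod -> M := quot_lift (free_lift sum_fun).

Hypotheses (f1h : lie_hom f1) (f2h : lie_hom f2).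

Lemma free_prod_rel_kill x : ideal_gen free_prod_rel x ->
  free_lift sum_fun x = 0.
Proof.
have lh := free_lift_hom sum_fun; have [llin lbr] := lh.
have lB y z : free_lift sum_fun (y - z) =
    free_lift sum_fun y - free_lift sum_fun z.
  by rewrite addrC -scaleN1r llin scaleN1r addrC.
apply: ideal_gen_kill lh _ x => _ [[a [x [y ->]]]|[x [y ->]]|[a [x [y ->]]]|[x [y ->]]].
- by rewrite lB llin !free_lift_gen /= f1h.1 subrr.
- by rewrite lB lbr !free_lift_gen /= f1h.2 subrr.
- by rewrite lB llin !free_lift_gen /= f2h.1 subrr.
- by rewrite lB lbr !free_lift_gen /= f2h.2 subrr.
Qed.

Lemma free_prod_lift_hom : lie_hom free_prod_lift.
Proof.
by apply: quot_lift_hom; [apply: free_lift_hom | apply: free_prod_rel_kill].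
Qed.

Lemma free_prod_lift_inl x : free_prod_lift (free_prod_inl x) = f1 x.
Proof.
rewrite /free_prod_lift quot_liftE ?free_lift_gen //; first exact: free_lift_hom.
exact: free_prod_rel_kill.
Qed.

Lemma free_prod_lift_inr x : free_prod_lift (free_prod_inr x) = f2 x.
Proof.
rewrite /free_prod_lift quot_liftE ?free_lift_gen //; first exact: free_lift_hom.
exact: free_prod_rel_kill.
Qed.

End FreeProduct.

Section WeakCommutativity.
Variables (K : fieldType) (g : lieType K).

(* The second factor of the free product g * g is the copy of g by psi. *)
Definition chi_rel : set (free_prod g g) :=
  [set bracket (free_prod_inl g x) (free_prod_inr g x) | x in [set: g]].

Definition chi : lieType K := lie_quot (LieIdeal (ideal_gen_closed chi_rel)).

Definition chi_inl (x : g) : chi := lie_proj _ (free_prod_inl g x).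
Definition chi_inr (x : g) : chi := lie_proj _ (free_prod_inr g x).

Definition alpha : chi -> g :=
  quot_lift (free_prod_lift (@id g) (@id g)).

Lemma lie_hom_id : lie_hom (@id g).
Proof. by []. Qed.

Lemma chi_rel_kill u : ideal_gen chi_rel u ->
  free_prod_lift (@id g) (@id g) u = 0.
Proof.
have lh := free_prod_lift_hom lie_hom_id lie_hom_id.
apply: ideal_gen_kill (lh) _ u => _ [x _ <-].
rewrite lh.2 (free_prod_lift_inl lie_hom_id lie_hom_id).
by rewrite (free_prod_lift_inr lie_hom_id lie_hom_id) bracketxx.
Qed.

Lemma alpha_hom : lie_hom alpha.
Proof.
apply: quot_lift_hom; last exact: chi_rel_kill.
exact: free_prod_lift_hom lie_hom_id lie_hom_id.
Qed.

Lemma alpha_inl x : alpha (chi_inl x) = x.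
Proof.
rewrite /alpha quot_liftE; last exact: chi_rel_kill.
  exact: free_prod_lift_inl lie_hom_id lie_hom_id x.
exact: free_prod_lift_hom lie_hom_id lie_hom_id.
Qed.

Lemma alpha_inr x : alpha (chi_inr x) = x.
Proof.
rewrite /alpha quot_liftE; last exact: chi_rel_kill.
  exact: free_prod_lift_inr lie_hom_id lie_hom_id x.
exact: free_prod_lift_hom lie_hom_id lie_hom_id.
Qed.

Definition chiL : set chi := [set u | alpha u = 0].

Definition chiR : set chi :=
  lie_comm (range chi_inl) (lie_comm chiL (range chi_inr)).

End WeakCommutativity.

Arguments chiL {K} g.
Arguments chiR {K} g.

Definition free_nilp2 (K : fieldType) (m : nat) : lieType K :=
  lie_quot (LieIdeal (gamma3_closed (free_lie K 'I_m))).

(* Main.v *)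
From HB Require Import structures.
Require Import Defs.
From mathcomp Require Import all_boot all_order all_algebra.
From mathcomp Require Import boolp classical_sets functions.
From mathcomp Require Import ring zify.

Set Implicit Arguments.
Unset Strict Implicit.
Unset Printing Implicit Defensive.

Import GRing.Theory.
Local Open Scope ring_scope.
Local Open Scope classical_set_scope.

(** Write [J x = x - x^psi] and [w(x, y) = [J x, J y]] in [chi g]. Polarising
    [[x, x^psi] = 0] gives, when 2 is invertible,
      [[x, J y] = (J [x, y] + w(x, y)) / 2] and
      [[x^psi, J y] = (J [x, y] - w(x, y)) / 2],
    and expanding [[[a, b], J c]] with these rules and the Jacobi identity shows
    that [[w(a, b), J c]] is [J [[a, b], c]]: the kernel [L] of [alpha] is the
    universal Lie algebra generated by the Lie triple system [g]. If [g] has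
    class 2 the triple product vanishes, so the [w(a, b)] commute with [L],
    and [chi g = g + J g + W] with [W] the span of the [w(a, b)]
    ([bracket_w_diff], [chi_decomp]). A direct computation then gives
      [[x, [J y, z^psi]] = tri(x, y, z) / 4],
      [tri(x, y, z) = w(x, [y, z]) + w(y, [z, x]) + w(z, [x, y])],
    and the other generators of [R(g)] are combinations of values of [tri]; hence
    [R(g)] is the span of all [tri(x, y, z)] ([chiR_tri]), the image of the
    Chevalley-Eilenberg differential from the third to the second exterior power
    of [g].

    For [g = V + [V, V]] free of class 2 on [e_1, ..., e_m], trilinearity and
    alternation leave two kinds of generators: [tri(e_i, e_j, e_k)] with
    [i < j < k], and [tri([s, t], x, y) = w([s, t], [x, y])], for which it is
    enough to take two of the [e_i, e_j] brackets in increasing order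
    ([chiR_span_basis]).

    These vectors are independent because [W] really is the exterior square of
    [g]. This is seen in an explicit model: with [G] the class 2 Lie algebra on
    the coordinate space of [V + (V (x) V)], the space [G + G + G (x) G] carries a
    Lie bracket following the rules above, both copies of [g] map to it, and
    [w(x, y)] goes to the antisymmetrised tensor of [x] and [y]. Entries of this
    tensor are the linear forms dual to the chosen vectors ([R_dual_basis]).
    The dimension is thus [C(m, 3) + C(C(m, 2), 2)]. *)

(** * Linear identities in a module by the ring tactic *)

(** The square-zero extension of [K] by [V], a commutative ring in which [V] is an
    ideal: an identity between linear combinations of vectors of [V] becomes an
    identity of commutative rings, within the scope of [ring]. *)

Definition sqz (K : fieldType) (V : lmodType K) : Type := (K * V)%type.
HB.instance Definition _ K V := GRing.Zmodule.on (@sqz K V).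

Section SquareZero.
Variables (K : fieldType) (V : lmodType K).
Local Notation A := (@sqz K V).
Definition sqz_mul (u v : A) : A := (u.1 * v.1, u.1 *: v.2 + v.1 *: u.2).
Lemma sqz_mulA : associative sqz_mul.
Proof.
move=> u v w; rewrite /sqz_mul /= mulrA; congr (_, _).
by rewrite !scalerDr !scalerA addrA [w.1 * u.1]mulrC [w.1 * v.1]mulrC.
Qed.

Lemma sqz_mulC : commutative sqz_mul.
Proof. by move=> u v; rewrite /sqz_mul mulrC addrC. Qed.

Lemma sqz_mul1 : left_id ((1, 0) : A) sqz_mul.
Proof. by case=> a u; rewrite /sqz_mul /= mul1r scale1r scaler0 addr0. Qed.

Lemma sqz_mulDl : left_distributive sqz_mul +%R.
Proof.
move=> u v w; rewrite /sqz_mul /= mulrDl !scalerDl !scalerDr.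
by congr (_, _); rewrite addrACA.
Qed.

Lemma sqz_1neq0 : ((1, 0) : A) != 0.
Proof. by apply/eqP => -[/eqP]; rewrite oner_eq0. Qed.

HB.instance Definition _ := GRing.Zmodule_isComNzRing.Build A
  sqz_mulA sqz_mulC sqz_mul1 sqz_mulDl sqz_1neq0.

Definition sqz_scal (a : K) : A := (a, 0).
Definition sqz_vec (u : V) : A := (0, u).
Lemma sqz_vec_inj : injective sqz_vec. Proof. by move=> u v []. Qed.

Lemma sqz_vec0 : sqz_vec 0 = 0. Proof. by []. Qed.

Lemma sqz_vecD u v : sqz_vec (u + v) = sqz_vec u + sqz_vec v.
Proof. by congr (_, _); rewrite addr0. Qed.

Lemma sqz_vecN u : sqz_vec (- u) = - sqz_vec u.
Proof. by congr (_, _); rewrite oppr0. Qed.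

Lemma sqz_vecMn u n : sqz_vec (u *+ n) = sqz_vec u *+ n.
Proof. by elim: n => // n IH; rewrite !mulrS sqz_vecD IH. Qed.

Lemma sqz_vecZ a u : sqz_vec (a *: u) = sqz_scal a * sqz_vec u.
Proof. by congr (_, _); rewrite /= ?mulr0 // scale0r addr0. Qed.

End SquareZero.

Ltac lmod_ring := apply: sqz_vec_inj;
  rewrite ?(sqz_vecD, sqz_vecN, sqz_vecMn, sqz_vecZ, sqz_vec0); ring.

(** * Lie algebras and subspaces *)

Section LieLinearity.
Variables (K : fieldType) (L : lieType K).
Implicit Types x y z : L.
Lemma bracketZl a x y : bracket (a *: x) y = a *: bracket x y.
Proof. by have := bracket_linearl y a x 0; rewrite !addr0 bracket0l addr0. Qed.

Lemma bracketZr a x y : bracket x (a *: y) = a *: bracket x y.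
Proof. by have := bracket_linearr x a y 0; rewrite !addr0 bracket0r addr0. Qed.

Lemma bracket_leibniz x y z :
  bracket x (bracket y z) = bracket (bracket x y) z + bracket y (bracket x z).
Proof.
have /eqP := jacobi x y z; rewrite -addrA addr_eq0 => /eqP ->.
by rewrite opprD -bracketNr -bracketC addrC -(bracketC (bracket x y)).
Qed.

End LieLinearity.

Definition bracketE := (bracketDl, bracketDr, bracketNl, bracketNr, bracketZl,
  bracketZr, bracket0l, bracket0r).

Section LieHom.
Variables (K : fieldType) (L M : lieType K) (f : L -> M).
Hypothesis fh : lie_hom f.
Lemma lie_homD x y : f (x + y) = f x + f y.
Proof. by have := fh.1 1 x y; rewrite !scale1r. Qed.

Lemma lie_homZ a x : f (a *: x) = a *: f x.
Proof. by have := fh.1 a x 0; rewrite !addr0 (lie_hom0 fh) addr0. Qed.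

Lemma lie_homN x : f (- x) = - f x.
Proof. by rewrite -scaleN1r lie_homZ scaleN1r. Qed.

Lemma lie_homB x y : f (x - y) = f x - f y.
Proof. by rewrite lie_homD lie_homN. Qed.

End LieHom.

Section Subspace.
Variables (K : fieldType) (V : lmodType K) (S : set V).
Hypothesis Ss : subspace S.
Lemma subspaceD u v : S u -> S v -> S (u + v).
Proof. by rewrite -{2}[u]scale1r; apply: Ss.2. Qed.

Lemma subspaceZ a u : S u -> S (a *: u).
Proof. by move=> Su; rewrite -[_ *: _]addr0; apply: Ss.2 => //; apply: Ss.1. Qed.

Lemma subspaceN u : S u -> S (- u).
Proof. by rewrite -scaleN1r; apply: subspaceZ. Qed.

Lemma subspaceB u v : S u -> S v -> S (u - v).
Proof. by move=> Su /subspaceN; apply: subspaceD. Qed.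

Lemma subspace_sum I (r : seq I) (P : pred I) (F : I -> V) :
  (forall i, P i -> S (F i)) -> S (\sum_(i <- r | P i) F i).
Proof. by move=> SF; apply: big_ind => //; [apply: Ss.1 | apply: subspaceD]. Qed.

End Subspace.

Lemma lspan_ind (K : fieldType) (V : lmodType K) (A P : set V) :
  subspace P -> A `<=` P -> lspan A `<=` P.
Proof. by move=> Ps AP; apply: smallest_sub. Qed.

Lemma lspan_mem (K : fieldType) (V : lmodType K) (A : set V) u : A u -> lspan A u.
Proof. exact: sub_gen_smallest. Qed.

Definition class2 (K : fieldType) (g : lieType K) : Prop :=
  forall x y z : g, bracket x (bracket y z) = 0.

(** * The weak commutativity construction *)

Section Chi.
Variables (K : fieldType) (g : lieType K).
Local Notation inl := (@chi_inl K g).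
Local Notation inr := (@chi_inr K g).

Lemma chi_inl_hom : lie_hom inl.
Proof.
have p := lie_proj_hom (LieIdeal (ideal_gen_closed (@chi_rel K g))).
have i := free_prod_inl_hom g g.
split=> [a x y | x y]; rewrite /chi_inl; first by rewrite i.1 p.1.
by rewrite i.2 p.2.
Qed.

Lemma chi_inr_hom : lie_hom inr.
Proof.
have p := lie_proj_hom (LieIdeal (ideal_gen_closed (@chi_rel K g))).
have i := free_prod_inr_hom g g.
split=> [a x y | x y]; rewrite /chi_inr; first by rewrite i.1 p.1.
by rewrite i.2 p.2.
Qed.

Lemma chi_weak_comm x : bracket (inl x) (inr x) = 0.
Proof.
have p := lie_proj_hom (LieIdeal (ideal_gen_closed (@chi_rel K g))).
rewrite /chi_inl /chi_inr -p.2 -lie_proj0; apply/lie_projP; rewrite subr0.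
by apply: sub_gen_smallest; exists x.
Qed.

Lemma chi_weak_commC x y : bracket (inl x) (inr y) = - bracket (inl y) (inr x).
Proof.
apply/eqP; rewrite -addr_eq0; apply/eqP.
have := chi_weak_comm (x + y).
rewrite (lie_homD chi_inl_hom) (lie_homD chi_inr_hom) !bracketE.
by rewrite !chi_weak_comm add0r addr0.
Qed.

(** [chi g] is generated as a Lie algebra by the two copies of [g]. *)
Lemma chi_ind (P : set (chi g)) : subspace P ->
  (forall x, P (inl x)) -> (forall x, P (inr x)) ->
  (forall u v, P u -> P v -> P (bracket u v)) -> forall u, P u.
Proof.
move=> Ps Pl Pr PB u.
have hp := lie_proj_hom (LieIdeal (ideal_gen_closed (@chi_rel K g))).
have hf := lie_proj_hom (LieIdeal (ideal_gen_closed (@free_prod_rel K g g))).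
rewrite -[u]lie_repK -[lie_rep u]lie_repK -[lie_rep (lie_rep u)]free_reprK.
elim: (free_repr _) => [[x|x]||s Ps' t Pt|a s Ps'|s Ps' t Pt].
- exact: Pl.
- exact: Pr.
- have -> : free_class (@Zero K (g + g)) = 0 by [].
  by rewrite (lie_hom0 hf) (lie_hom0 hp); apply: Ps.1.
- by rewrite free_classD (lie_homD hf) (lie_homD hp); apply: subspaceD.
- by rewrite free_classZ (lie_homZ hf) (lie_homZ hp); apply: subspaceZ.
- by rewrite -free_bracketE -/(bracket _ _) hf.2 hp.2; apply: PB.
Qed.

Section Lift.
Variables (M : lieType K) (f1 f2 : g -> M).
Hypotheses (f1h : lie_hom f1) (f2h : lie_hom f2).
Hypothesis f12 : forall x, bracket (f1 x) (f2 x) = 0.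
Definition chi_lift : chi g -> M := quot_lift (free_prod_lift f1 f2).
Lemma chi_lift_kill u : ideal_gen (@chi_rel K g) u -> free_prod_lift f1 f2 u = 0.
Proof.
have lh := free_prod_lift_hom f1h f2h.
apply: ideal_gen_kill (lh) _ u => _ [x _ <-].
by rewrite lh.2 free_prod_lift_inl // free_prod_lift_inr.
Qed.

Lemma chi_lift_hom : lie_hom chi_lift.
Proof.
by apply: quot_lift_hom; [apply: free_prod_lift_hom | apply: chi_lift_kill].
Qed.

Lemma chi_lift_inl x : chi_lift (inl x) = f1 x.
Proof.
rewrite /chi_lift quot_liftE; first exact: free_prod_lift_inl.
  exact: free_prod_lift_hom.
exact: chi_lift_kill.
Qed.

Lemma chi_lift_inr x : chi_lift (inr x) = f2 x.
Proof.
rewrite /chi_lift quot_liftE; first exact: free_prod_lift_inr.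
  exact: free_prod_lift_hom.
exact: chi_lift_kill.
Qed.

End Lift.

(** Locked because [rewrite] would otherwise see the difference through the
    definition and expand brackets with [chi_diff x] in two terms. *)
Definition chi_diff (x : g) : chi g := locked (inl x - inr x).
Local Notation J := chi_diff.
Definition chi_w (x y : g) : chi g := bracket (J x) (J y).
Local Notation w := chi_w.
(** Up to sign, the Chevalley-Eilenberg boundary of [x /\ y /\ z]. *)
Definition chi_tri (x y z : g) : chi g :=
  w x (bracket y z) + w y (bracket z x) + w z (bracket x y).

Lemma chi_diffD x y : J (x + y) = J x + J y.
Proof.
by rewrite /J -!lock (lie_homD chi_inl_hom) (lie_homD chi_inr_hom) opprD addrACA.
Qed.

Lemma chi_diffZ a x : J (a *: x) = a *: J x.
Proof. by rewrite /J -!lock (lie_homZ chi_inl_hom) (lie_homZ chi_inr_hom) scalerBr. Qed.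

Lemma chi_diff0 : J 0 = 0.
Proof. by rewrite -(scale0r 0) chi_diffZ scale0r. Qed.

Lemma chi_diffN x : J (- x) = - J x.
Proof. by rewrite -scaleN1r chi_diffZ scaleN1r. Qed.

Definition chi_diffE := (chi_diffD, chi_diffZ, chi_diffN, chi_diff0).

Lemma chi_wDl x y z : w (x + y) z = w x z + w y z.
Proof. by rewrite /w chi_diffD bracketDl. Qed.

Lemma chi_wZl a x y : w (a *: x) y = a *: w x y.
Proof. by rewrite /w chi_diffZ bracketZl. Qed.

Lemma chi_wDr x y z : w z (x + y) = w z x + w z y.
Proof. by rewrite /w chi_diffD bracketDr. Qed.

Lemma chi_wZr a x y : w x (a *: y) = a *: w x y.
Proof. by rewrite /w chi_diffZ bracketZr. Qed.

Lemma chi_wC x y : w x y = - w y x. Proof. exact: bracketC. Qed.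

Lemma chi_wxx x : w x x = 0. Proof. exact: bracketxx. Qed.

Lemma chi_w0l x : w 0 x = 0. Proof. by rewrite /w chi_diff0 bracket0l. Qed.

Lemma chi_w0r x : w x 0 = 0. Proof. by rewrite /w chi_diff0 bracket0r. Qed.

Lemma chi_wNl x y : w (- x) y = - w x y.
Proof. by rewrite /w chi_diffN bracketNl. Qed.

Lemma chi_wNr x y : w x (- y) = - w x y.
Proof. by rewrite /w chi_diffN bracketNr. Qed.

Lemma chi_tri_cycle x y z : chi_tri x y z = chi_tri y z x.
Proof. by rewrite /chi_tri -addrA addrC. Qed.

Lemma chi_tri_swap x y z : chi_tri x y z = - chi_tri y x z.
Proof.
rewrite /chi_tri (bracketC y z) (bracketC z x) (bracketC x y) !chi_wNr.
lmod_ring.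
Qed.

Lemma chi_tri_xx x y : chi_tri x x y = 0.
Proof.
by rewrite /chi_tri bracketxx chi_w0r (bracketC y x) chi_wNr addr0 subrr.
Qed.

Lemma chi_tri_linear y z : linear (fun x => chi_tri x y z).
Proof.
move=> a x1 x2; rewrite /chi_tri !bracketE.
rewrite !(chi_wDl, chi_wZl, chi_wDr, chi_wZr).
lmod_ring.
Qed.

Hypothesis char2 : 2%N \notin [pchar K].
Hypothesis g2 : class2 g.
Local Notation h := (2%:R^-1 : K).

Lemma halfZ (V : lmodType K) (u : V) : u = h *: (u *+ 2).
Proof.
have n2 : 2%:R != 0 :> K by move: char2; rewrite inE.
by rewrite -scaler_nat scalerA mulVf // scale1r.
Qed.

Lemma quarterZ (V : lmodType K) (u : V) : u = h *: (h *: (u *+ 4)).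
Proof. by rewrite [LHS]halfZ [in LHS](halfZ (u *+ 2)) -mulrnA. Qed.

(** Both sides are combinations of [[x, y]], [[x, y]^psi] and [[x, y^psi]], since
    polarisation identifies [[x^psi, y]] with [[x, y^psi]]. *)
Lemma bracket_inl_diff x y : bracket (inl x) (J y) = h *: (J (bracket x y) + w x y).
Proof.
rewrite [LHS]halfZ; congr (_ *: _).
rewrite /w /J -!lock !bracketE (chi_inl_hom).2 (chi_inr_hom).2.
rewrite (bracketC (inr x) (inl y)) (chi_weak_commC y x).
lmod_ring.
Qed.

Lemma bracket_inr_diff x y : bracket (inr x) (J y) = h *: (J (bracket x y) - w x y).
Proof.
have -> : inr x = inl x - J x by rewrite /J -lock opprB addrC subrK.
rewrite bracketDl bracketNl bracket_inl_diff -/(w x y).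
rewrite [in X in _ - X](halfZ (w x y)).
lmod_ring.
Qed.

(** The derivation rule; its last two terms vanish by [bracket_w_diff], whose
    proof needs this form. *)
Lemma bracket_inl_w_full a b c :
  bracket (inl a) (w b c) = h *: (w (bracket a b) c + w b (bracket a c)
    + bracket (w a b) (J c) - bracket (w a c) (J b)).
Proof.
rewrite [w b c]/w bracket_leibniz !bracket_inl_diff !bracketE.
rewrite (bracketC (J b) (w a c)).
lmod_ring.
Qed.

(** Compute [[[a, b], J c]] in two ways, directly and as the commutator of the
    actions of [a] and [b]. In class 2 the terms in [w] cancel, and what is left,
    simplified by the Jacobi identity for [J a], [J b], [J c], is a quarter of
    [[w(a, b), J c]]. *)
Lemma bracket_w_diff a b c : bracket (w a b) (J c) = 0.
Proof.
have jac : bracket (w b c) (J a) = bracket (w a c) (J b) - bracket (w a b) (J c).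
  have := jacobi (J a) (J b) (J c).
  rewrite (bracketC (J c) (J a)) bracketNr (bracketC _ (w b c)) (bracketC _ (w a c)).
  by rewrite (bracketC _ (w a b)) => E; rewrite -[LHS]addr0 -E; lmod_ring.
have := bracket_leibniz (inl a) (inl b) (J c).
rewrite -(chi_inl_hom).2 !(bracket_inl_diff, bracketE, bracket_inl_w_full) !g2.
rewrite (bracketC (bracket a b) c) g2 oppr0 chi_diff0 !add0r jac => E.
(* The two sides have different degrees in 1/2: the ring tactic does not know
   that 2 times 1/2 is 1, so the term of lower degree is homogenised first. *)
have {E} := E; rewrite [in RHS](halfZ (w (bracket a b) c)) => E.
rewrite (bracketC b a) chi_wNl (chi_wC b a) bracketNl in E.
move/eqP: E; rewrite -subr_eq0 => /eqP E.
rewrite [LHS]quarterZ -[RHS](mul0rn _ 4) -E; lmod_ring.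
Qed.

Lemma bracket_inl_w a b c :
  bracket (inl a) (w b c) = h *: (w (bracket a b) c + w b (bracket a c)).
Proof. by rewrite bracket_inl_w_full !bracket_w_diff subr0 addr0. Qed.

Lemma bracket_diff_w a b c : bracket (J c) (w a b) = 0.
Proof. by rewrite bracketC bracket_w_diff oppr0. Qed.

Lemma bracket_inr_w a b c :
  bracket (inr a) (w b c) = h *: (w (bracket a b) c + w b (bracket a c)).
Proof.
have -> : inr a = inl a - J a by rewrite /J -lock opprB addrC subrK.
by rewrite bracketDl bracketNl bracket_diff_w subr0 bracket_inl_w.
Qed.

Definition chi_W : set (chi g) := lspan [set u | exists x y, u = w x y].

(** The subspace on the right contains both copies of [g], and it is closed under
    brackets because [W] is stable under [g] and commutes with [J g] and [W]. *)
Lemma chi_decomp (u : chi g) : exists (x y : g) (v : chi g), chi_W v /\ u = inl x + J y + v.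
Proof.
have Ws : subspace chi_W by apply: lspan_subspace.
have in_W x y : chi_W (w x y) by apply: lspan_mem; exists x, y.
have inlW x v : chi_W v -> chi_W (bracket (inl x) v).
  move: v; apply: (@lspan_ind _ _ _ [set v | chi_W (bracket (inl x) v)]).
    split=> [|a u1 v hu hv] /=; first by rewrite bracket0r; apply: Ws.1.
    by rewrite bracket_linearr; apply: Ws.2.
  move=> _ [y [z ->]] /=; rewrite bracket_inl_w.
  by apply: (subspaceZ Ws); apply: (subspaceD Ws).
have JW x v : chi_W v -> bracket (J x) v = 0.
  move: v; apply: (@lspan_ind _ _ _ [set v | bracket (J x) v = 0]).
    split=> [|a u1 v hu hv] /=; first by rewrite bracket0r.
    by rewrite bracket_linearr hu hv scaler0 addr0.
  by move=> _ [y [z ->]] /=; rewrite bracket_diff_w.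
have WW u1 v : chi_W u1 -> chi_W v -> bracket u1 v = 0.
  move=> + Wv; move: u1; apply: (@lspan_ind _ _ _ [set u | bracket u v = 0]).
    split=> [|a u1 v1 hu hv] /=; first by rewrite bracket0l.
    by rewrite bracket_linearl hu hv scaler0 addr0.
  move=> _ [y [z ->]] /=.
  rewrite bracketC [w y z]/w bracket_leibniz.
  by rewrite !(bracketC v) !JW // !(oppr0, bracket0l, bracket0r) ?addr0 ?oppr0 //; apply: Ws.1.
pose P : set (chi g) := [set u | exists (x y : g) (v : chi g), chi_W v /\ u = inl x + J y + v].
move: u; apply: (@chi_ind P).
- split=> [|a _ _ [x1 [y1 [v1 [W1 ->]]]] [x2 [y2 [v2 [W2 ->]]]]].
    exists 0, 0, 0; split; first exact: Ws.1.
    by rewrite (lie_hom0 chi_inl_hom) chi_diff0 !addr0.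
  exists (a *: x1 + x2), (a *: y1 + y2), (a *: v1 + v2).
  split; first exact: Ws.2.
  by rewrite chi_inl_hom.1 chi_diffD chi_diffZ; lmod_ring.
- move=> x; exists x, 0, 0; split; first exact: Ws.1.
  by rewrite chi_diff0 !addr0.
- move=> x; exists x, (- x), 0; split; first exact: Ws.1.
  by rewrite chi_diffN addr0 /J -lock opprB addrC subrK.
- move=> _ _ [x1 [y1 [v1 [W1 ->]]]] [x2 [y2 [v2 [W2 ->]]]].
  exists (bracket x1 x2), (h *: (bracket x1 y2 - bracket x2 y1)),
    (h *: (w x1 y2 - w x2 y1) + w y1 y2 + bracket (inl x1) v2 - bracket (inl x2) v1).
  split.
    apply: (subspaceB Ws); last exact: inlW.
    apply: (subspaceD Ws); last exact: inlW.
    apply: (subspaceD Ws) => //.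
    by apply: (subspaceZ Ws); apply: (subspaceB Ws).
  rewrite !bracketE -(chi_inl_hom).2 (bracketC (J y1) (inl x2)) !bracket_inl_diff.
  rewrite (JW y1 v2) // (bracketC v1 (inl x2)) (bracketC v1 (J y2)) (JW y2 v1) // (WW v1) //.
  rewrite -[bracket (J y1) (J y2)]/(w y1 y2) !chi_diffE.
  by rewrite ?oppr0; lmod_ring.
Qed.

(** In class 2 two of the three terms contain a double bracket. *)
Lemma chi_tri_br_l s t x y : chi_tri (bracket s t) x y = w (bracket s t) (bracket x y).
Proof.
rewrite /chi_tri g2 (bracketC _ x) g2 oppr0 !chi_w0r.
by rewrite !addr0.
Qed.

Lemma bracket_inl_diff_inr x y z :
  bracket (inl x) (bracket (J y) (inr z)) = h *: (h *: chi_tri x y z).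
Proof.
rewrite (bracketC (J y)) bracket_inr_diff (bracketC z) (chi_wC z).
rewrite bracketNr bracketZr bracketDr bracketNr chi_diffN !bracketNr.
rewrite bracket_inl_diff bracket_inl_w g2 chi_diff0.
rewrite /chi_tri (bracketC z x) (chi_wC z) chi_wNr.
by lmod_ring.
Qed.

Lemma bracket_inl_w_inr x a b c :
  bracket (inl x) (bracket (w a b) (inr c)) = - (h *: (h *:
    (chi_tri (bracket c a) x b + chi_tri (bracket x a) c b))).
Proof.
rewrite (bracketC (w a b)) bracket_inr_w bracketNr bracketZr bracketDr.
by rewrite !bracket_inl_w !g2 chi_w0l chi_w0r add0r addr0 !chi_tri_br_l -scalerDr.
Qed.

Lemma alpha_diff x : alpha (J x) = 0.
Proof.
by rewrite /J -lock (lie_homB (alpha_hom g)) alpha_inl alpha_inr subrr.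
Qed.

Lemma chiL_decomp u : chiL g u -> exists (y : g) (v : chi g), chi_W v /\ u = J y + v.
Proof.
have aW v : chi_W v -> alpha v = 0.
  move: v; apply: (@lspan_ind _ _ _ [set v | alpha v = 0]).
    split=> [|a u1 v1 hu hv] /=; first exact: lie_hom0 (alpha_hom g).
    by rewrite (alpha_hom g).1 hu hv scaler0 addr0.
  by move=> _ [x [y ->]] /=; rewrite (alpha_hom g).2 !alpha_diff bracket0l.
have [x [y [v [Wv ->]]]] := chi_decomp u.
rewrite /chiL /= !(lie_homD (alpha_hom g)) alpha_inl alpha_diff aW // !addr0.
by move=> ->; exists y, v; rewrite (lie_hom0 chi_inl_hom) add0r.
Qed.

(** By [chi_decomp] the elements of [L] are [J y + v] with [v] in [W], and
    [bracket_inl_diff_inr] and [bracket_inl_w_inr] treat the two summands. The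
    first one, divided by its factor 1/4, also gives the reverse inclusion. *)
Lemma chiR_tri : chiR g = lspan [set u | exists x y z, u = chi_tri x y z].
Proof.
set T := [set u | _].
have Ts : subspace (lspan T) by apply: lspan_subspace.
have inT x y z : lspan T (chi_tri x y z) by apply: lspan_mem; exists x, y, z.
apply/seteqP; split.
  apply: lspan_ind => // _ [_ [x _ <-]] [v Lv <-].
  move: v Lv; apply: (@lspan_ind _ _ _ [set v | lspan T (bracket (inl x) v)]).
    split=> [|a u1 v1 hu hv] /=; first by rewrite bracket0r; apply: Ts.1.
    by rewrite bracket_linearr; apply: Ts.2.
  move=> _ [_ /chiL_decomp[y [v [Wv ->]]] [_ [z _ <-] <-]] /=.
  rewrite bracketDl bracketDr; apply: (subspaceD Ts).
    rewrite bracket_inl_diff_inr; do 2 apply: (subspaceZ Ts); exact: inT.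
  move: v Wv; apply: (@lspan_ind _ _ _
      [set v | lspan T (bracket (inl x) (bracket v (inr z)))]).
    split=> [|a u1 v1 hu hv] /=; first by rewrite bracket0l bracket0r; apply: Ts.1.
    by rewrite bracket_linearl bracket_linearr; apply: Ts.2.
  move=> _ [a [b ->]] /=; rewrite bracket_inl_w_inr; apply: (subspaceN Ts).
  by do 2 apply: (subspaceZ Ts); apply: (subspaceD Ts).
have Rs : subspace (chiR g) by apply: lspan_subspace.
apply: lspan_ind => // _ [x [y [z ->]]].
rewrite [chi_tri _ _ _]quarterZ -!scalerMnr -bracket_inl_diff_inr -scaler_nat.
apply: (subspaceZ Rs); apply: lspan_mem; exists (inl x); first by exists x.
exists (bracket (J y) (inr z)) => //; apply: lspan_mem.
by exists (J y); [exact: alpha_diff | exists (inr z) => //; exists z].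
Qed.

End Chi.

Definition fct_ptE := (addrfctE, opprfctE, scalrfctE).

(** * A concrete model *)

Section Model.
Variables (K : fieldType) (m : nat).
(** Coordinates of [V + (V (x) V)] for [V] of dimension [m]. *)
Definition nilp_idx : Type := ('I_m + 'I_m * 'I_m)%type.

Definition nilp_coord : Type := nilp_idx -> K^o.
HB.instance Definition _ := GRing.Lmodule.copy nilp_coord (nilp_idx -> K^o).
Definition nilp_br (x y : nilp_idx -> K) (p : nilp_idx) : K :=
  match p with
  | inl i => 0
  | inr (i, j) => x (inl i) * y (inl j) - x (inl j) * y (inl i)
  end.
Lemma nilp_br_linearl (z : nilp_coord) :
  linear (fun x : nilp_coord => nilp_br x z : nilp_coord).
Proof.
move=> a x y; apply/funext => -[i|[i j]]; rewrite /= !fct_ptE /=; first by rewrite scaler0 addr0.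
rewrite /GRing.scale /=.
by ring.
Qed.

Lemma nilp_br_linearr (z : nilp_coord) :
  linear (nilp_br z : nilp_coord -> nilp_coord).
Proof.
move=> a x y; apply/funext => -[i|[i j]]; rewrite /= !fct_ptE /=; first by rewrite scaler0 addr0.
rewrite /GRing.scale /=.
by ring.
Qed.

Lemma nilp_brxx (x : nilp_coord) : (nilp_br x x : nilp_coord) = 0.
Proof. by apply/funext => -[i|[i j]] //=; rewrite mulrC subrr. Qed.

Lemma nilp_br_br (x y z : nilp_idx -> K) : nilp_br x (nilp_br y z) = 0 :> nilp_coord.
Proof. by apply/funext => -[i|[i j]] //=; rewrite !mulr0 subr0. Qed.

Lemma nilp_jacobi (x y z : nilp_coord) :
  (nilp_br x (nilp_br y z) : nilp_coord) + nilp_br y (nilp_br z x) + nilp_br z (nilp_br x y) = 0.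
Proof. by rewrite !nilp_br_br !addr0. Qed.

HB.instance Definition _ := Lmodule_isLie.Build K nilp_coord
  nilp_br_linearl nilp_br_linearr nilp_brxx nilp_jacobi.

(** The antisymmetrised tensor of [x] and [y]; elements of [G (x) G] are functions
    of two coordinates. *)
Definition wedge (x y : nilp_idx -> K) : nilp_idx -> nilp_idx -> K^o :=
  fun p q => x p * y q - x q * y p.
(** The derivation [y (x) z |-> [x, y] (x) z + y (x) [x, z]] of the tensor square. *)
Definition wact (x : nilp_idx -> K) (t : nilp_idx -> nilp_idx -> K) : nilp_idx -> nilp_idx -> K^o :=
  fun p q => nilp_br x (t^~ q) p + nilp_br x (t p) q.

Lemma wact0 (x : nilp_idx -> K) : wact x 0 = 0.
Proof.
apply/funext => p; apply/funext => q; rewrite /wact -[RHS]/(0 : K).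
by case: p q => [i|[i j]] [k|[k l]]; rewrite /= -!/(0 : K) !(mulr0, addr0, subr0).
Qed.

Hypothesis char2 : 2%N \notin [pchar K].
Lemma two_neq0 : 2%:R != 0 :> K.
Proof. by move: char2; rewrite inE. Qed.

(** The triple [(x, y, t)] stands for [x + J y + t] with [t] in [W]. The
    invertibility of 2 is an argument of the type so that the Lie algebra instance
    can use it for the Jacobi identity. *)
Definition chi_coord (_ : 2%N \notin [pchar K]) : Type :=
  (nilp_coord * nilp_coord * (nilp_idx -> nilp_idx -> K^o))%type.
HB.instance Definition _ := GRing.Lmodule.copy (chi_coord char2)
  (nilp_coord * nilp_coord * (nilp_idx -> nilp_idx -> K^o))%type.
Local Notation h := (2%:R^-1 : K).
(** Imposes [[x, J y] = (J [x, y] + x /\ y) / 2], [[J y, J y'] = y /\ y'] and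
    lets [x] act on [W] by half of the derivation [wact x]. *)
Definition chi_br (u v : chi_coord char2) : chi_coord char2 :=
  (bracket u.1.1 v.1.1,
   h *: (bracket u.1.1 v.1.2 - bracket v.1.1 u.1.2),
   h *: (wedge u.1.1 v.1.2 - wedge v.1.1 u.1.2
         + wact u.1.1 v.2 - wact v.1.1 u.2) + wedge u.1.2 v.1.2).

Lemma chi_br_linearl w : linear (chi_br^~ w).
Proof.
move=> a u v; rewrite /chi_br /=; congr (_, _, _).
- by rewrite bracket_linearl.
- rewrite bracket_linearl bracket_linearr; lmod_ring.
apply/funext => p; apply/funext => q.
rewrite /wedge /wact /=. rewrite !fct_ptE /=.
by case: p q => [i|[i j]] [k|[k l]]; rewrite /= ?fct_ptE /GRing.scale /=; ring.
Qed.

Lemma chi_brxx u : chi_br u u = 0.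
Proof.
rewrite /chi_br; congr (_, _, _); first exact: bracketxx.
  by rewrite subrr scaler0.
apply/funext => p; apply/funext => q.
rewrite /wedge /wact /= !fct_ptE -[RHS]/(0 : K) /GRing.scale /=.
by ring.
Qed.

Lemma chi_br_linearr w : linear (chi_br w).
Proof.
have C u v : chi_br u v = - chi_br v u.
  rewrite /chi_br; congr (_, _, _); first exact: bracketC.
    by rewrite -scalerN opprB.
  apply/funext => p; apply/funext => q.
  by rewrite /wedge /wact /= !fct_ptE /GRing.scale /=; ring.
move=> a u v; rewrite C chi_br_linearl opprD -scalerN.
by rewrite -!C.
Qed.

Lemma chi_br_jacobi u v w :
  chi_br u (chi_br v w) + chi_br v (chi_br w u) + chi_br w (chi_br u v) = 0.
Proof.
case: u v w => [[x1 y1] t1] [[x2 y2] t2] [[x3 y3] t3].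
rewrite /chi_br /=; congr (_, _, _); rewrite /=.
- exact: jacobi.
- have b2 (x y z : nilp_coord) : bracket x (bracket y z) = 0 by exact: nilp_br_br.
  have b2' (x y z : nilp_coord) : bracket (bracket y z) x = 0 by rewrite bracketC b2 oppr0.
  by rewrite !bracketE !b2 !b2' !(subrr, scaler0, addr0).
apply/funext => p; apply/funext => q.
rewrite /wedge /wact /bracket /= !fct_ptE -[RHS]/(0 : K) /=.
by case: p q => [i|[i j]] [k|[k l]]; rewrite /= ?fct_ptE /GRing.scale /=; field; exact: two_neq0.
Qed.

HB.instance Definition _ := Lmodule_isLie.Build K (chi_coord char2)
  chi_br_linearl chi_br_linearr chi_brxx chi_br_jacobi.
End Model.

(** * The map from the construction on the free class 2 algebra to the model *)

Section Hom.
Variables (K : fieldType) (m : nat).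
Hypothesis char2 : 2%N \notin [pchar K].
Local Notation g := (free_nilp2 K m).
Local Notation h := (2%:R^-1 : K).

Definition nilp_gen (i : 'I_m) : g := lie_proj _ (free_gen i).
Local Notation e := nilp_gen.

Lemma nilp2_class2 : class2 g.
Proof.
have hp := lie_proj_hom (LieIdeal (gamma3_closed (free_lie K 'I_m))).
move=> x y z; rewrite -[x]lie_repK -[y]lie_repK -[z]lie_repK.
move: (lie_rep x) (lie_rep y) (lie_rep z) => {}x {}y {}z.
rewrite -[bracket (lie_proj _ y) _]hp.2 -hp.2 -lie_proj0.
apply/lie_projP; rewrite subr0.
suff: gamma3 (bracket x (bracket y z)) by [].
apply: lspan_mem; exists x => //; exists (bracket y z) => //.
by apply: lspan_mem; exists y => //; exists z.
Qed.

(** The span of the [e i] and the [[e i, e j]] is a subalgebra, as all longer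
    brackets vanish. *)
Lemma nilp2_ind (P : set g) : subspace P -> (forall i, P (e i)) ->
  (forall i j, P (bracket (e i) (e j))) -> forall x, P x.
Proof.
have hp := lie_proj_hom (LieIdeal (gamma3_closed (free_lie K 'I_m))).
move=> Ps Pe Pb x.
pose E := lspan [set x : g | (exists i, x = e i) \/ exists i j, x = bracket (e i) (e j)].
suff: E x.
  move: x; apply: (@lspan_ind _ _ _ P) => // _ [[i ->]|[i [j ->]]] //.
have Es : subspace E by apply: lspan_subspace.
rewrite -[x]lie_repK -[lie_rep x]free_reprK.
elim: (free_repr _) => [i||s Hs t Ht|a s Hs|s Hs t Ht].
- by apply: lspan_mem; left; exists i.
- have -> : free_class (@Zero K 'I_m) = 0 by [].
  by rewrite lie_proj0; apply: Es.1.
- by rewrite free_classD (lie_homD hp); apply: (subspaceD Es).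
- by rewrite free_classZ (lie_homZ hp); apply: (subspaceZ Es).
rewrite -free_bracketE -/(bracket _ _) hp.2.
move: (lie_proj _ _) Hs (lie_proj _ _) Ht => u Eu v Ev.
move: v Ev; apply: (@lspan_ind _ _ _ [set v | E (bracket u v)]).
  split=> [|a v1 v2 H1 H2] /=; first by rewrite bracket0r; apply: Es.1.
  by rewrite bracket_linearr; apply: Es.2.
move=> _ [[j ->]|[i [j ->]]] /=; last by rewrite nilp2_class2; apply: Es.1.
move: u Eu; apply: (@lspan_ind _ _ _ [set u | E (bracket u (e j))]).
  split=> [|a v1 v2 H1 H2] /=; first by rewrite bracket0l; apply: Es.1.
  by rewrite bracket_linearl; apply: Es.2.
move=> _ [[i ->]|[i [k ->]]] /=.
  by apply: lspan_mem; right; exists i, j.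
by rewrite bracketC nilp2_class2 oppr0; apply: Es.1.
Qed.

Definition coord_gen (i : 'I_m) : nilp_coord K m := fun p => (p == inl i)%:R.
Definition to_coord : g -> nilp_coord K m := quot_lift (free_lift coord_gen).
Lemma coord_gamma3 x : gamma3 x -> free_lift coord_gen x = 0.
Proof.
have fh := free_lift_hom coord_gen.
move: x; apply: (@lspan_ind _ _ _ [set x | free_lift coord_gen x = 0]).
  split=> [|a u v hu hv] /=; first exact: lie_hom0.
  by rewrite fh.1 hu hv scaler0 addr0.
move=> _ [x _ [y gy <-]] /=; rewrite fh.2.
move: y gy; apply: (@lspan_ind _ _ _
    [set y | bracket (free_lift coord_gen x) (free_lift coord_gen y) = 0]).
  split=> [|a u v hu hv] /=; first by rewrite (lie_hom0 fh) bracket0r.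
  by rewrite fh.1 bracket_linearr hu hv scaler0 addr0.
by move=> _ [y _ [z _ <-]] /=; rewrite fh.2; apply: nilp_br_br.
Qed.

Lemma to_coord_hom : lie_hom to_coord.
Proof. by apply: quot_lift_hom; [exact: free_lift_hom | exact: coord_gamma3]. Qed.

Lemma to_coord_gen i : to_coord (e i) = coord_gen i.
Proof.
rewrite /to_coord quot_liftE ?free_lift_gen //; first exact: free_lift_hom.
exact: coord_gamma3.
Qed.

Definition model_inl (x : g) : chi_coord m char2 := (to_coord x, 0, 0).
Definition model_inr (x : g) : chi_coord m char2 := (to_coord x, - to_coord x, 0).
Lemma model_inl_hom : lie_hom model_inl.
Proof.
split=> [a x y|x y].
  by rewrite /model_inl to_coord_hom.1; congr (_, _, _); rewrite /= scaler0 addr0.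
rewrite /model_inl to_coord_hom.2 /bracket /= /chi_br /=; congr (_, _, _).
  by rewrite !bracket0r subrr scaler0.
apply/funext => p; apply/funext => q.
rewrite /wedge /wact /= !fct_ptE /=.
case: p q => [i|[i j]] [k|[k l]]; rewrite -?[LHS]/(0 : K) /GRing.scale /= -!/(0 : K).
all: by rewrite !(mul0r, mulr0, addr0, subr0, oppr0).
Qed.

Lemma model_inr_hom : lie_hom model_inr.
Proof.
split=> [a x y|x y].
  rewrite /model_inr to_coord_hom.1; congr (_, _, _); rewrite /=; first by lmod_ring.
  by rewrite scaler0 addr0.
rewrite /model_inr to_coord_hom.2 /bracket /= /chi_br /=; congr (_, _, _).
  rewrite !bracketNr (bracketC (to_coord y)) opprK -opprD -mulr2n scalerN.
  by rewrite -(halfZ char2).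
rewrite !wact0 subr0 addr0; apply/funext => p; apply/funext => q.
rewrite /wedge !fct_ptE -[LHS]/(0 : K) /GRing.scale /=.
by field; exact: two_neq0.
Qed.

Lemma model_comm x : bracket (model_inl x) (model_inr x) = 0.
Proof.
rewrite /bracket /= /chi_br /= bracketxx bracketNr bracketxx bracket0r oppr0 addr0 scaler0.
congr (_, _, _).
rewrite !wact0 subr0 addr0; apply/funext => p; apply/funext => q.
rewrite /wedge !fct_ptE -[RHS]/(0 : K) -[(0 : nilp_coord K m) p]/(0 : K)
  -[(0 : nilp_coord K m) q]/(0 : K) /GRing.scale /=.
by ring.
Qed.

Definition model : chi g -> chi_coord m char2 := chi_lift model_inl model_inr.
Lemma model_hom : lie_hom model.
Proof. exact: chi_lift_hom model_inl_hom model_inr_hom model_comm. Qed.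

Lemma model_diff x : model (chi_diff x) = (0, to_coord x, 0).
Proof.
rewrite /chi_diff -lock (lie_homB model_hom).
rewrite /model (chi_lift_inl model_inl_hom model_inr_hom model_comm).
rewrite (chi_lift_inr model_inl_hom model_inr_hom model_comm).
congr (_, _, _); rewrite /=; first exact: subrr.
  by rewrite sub0r opprK.
exact: subrr.
Qed.

(** Coordinates of the [W] component in the model. *)
Definition wcoef (p q : nilp_idx m) (u : chi g) : K := (model u).2 p q.
Lemma wcoef_linear p q : linear (wcoef p q : chi g -> K^o).
Proof. by move=> a u v; rewrite /wcoef model_hom.1. Qed.

Lemma wcoef_w p q x y :
  wcoef p q (chi_w x y) = to_coord x p * to_coord y q - to_coord x q * to_coord y p.
Proof.
rewrite /wcoef /chi_w model_hom.2 !model_diff /bracket /= /chi_br /=.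
rewrite !wact0 subr0 addr0 /wedge !fct_ptE
  -[(0 : nilp_coord K m) p]/(0 : K) -[(0 : nilp_coord K m) q]/(0 : K) /GRing.scale /=.
by ring.
Qed.

End Hom.

(** * Bases and increasing tuples *)

Section Families.
Variables (K : fieldType) (V : lmodType K) (T : finType) (v : T -> V).

Lemma lspan_range : lspan (range v) = [set u | exists c : T -> K, u = \sum_t c t *: v t].
Proof.
apply/seteqP; split; last first.
  move=> _ [c ->]; have Ss : subspace (lspan (range v)) by exact: lspan_subspace.
  apply: (subspace_sum Ss) => t _; apply: (subspaceZ Ss).
  by apply: lspan_mem; exists t.
apply: lspan_ind.
  split=> [|a _ _ [c ->] [d ->]].
    by exists (fun=> 0); rewrite big1 // => t _; rewrite scale0r.
  exists (fun t => a * c t + d t); rewrite scaler_sumr -big_split /=.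
  by apply: eq_bigr => t _; rewrite scalerDl scalerA.
move=> _ [t _ <-]; exists (fun s => (s == t)%:R).
rewrite (bigD1 t) //= eqxx scale1r big1 ?addr0 // => s /negPf ->.
by rewrite scale0r.
Qed.

(** A family with a biorthogonal family of linear forms is a basis of its span. *)
Lemma has_dim_dual (f : T -> V -> K^o) : (forall t, linear (f t)) ->
  (forall s t, f s (v t) = (s == t)%:R) -> has_dim (lspan (range v)) #|T|.
Proof.
move=> flin fv; exists (fun i => v (enum_val i)); split.
  move=> c c0 i.
  have f0 t : f t 0 = 0 by have := flin t (-1) 0 0; rewrite !scaleN1r !addNr.
  have fD t : {morph f t : x y / x + y} by move=> x y; have := flin t 1 x y; rewrite !scale1r.
  have := congr1 (f (enum_val i)) c0.
  rewrite f0 (big_morph _ (fD _) (f0 _)) (bigD1 i) //= big1 => [|j /negPf ji].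
    have := flin (enum_val i) (c i) (v (enum_val i)) 0.
    by rewrite f0 !addr0 fv eqxx => ->; rewrite /GRing.scale /= mulr1.
  have := flin (enum_val i) (c j) (v (enum_val j)) 0.
  by rewrite f0 !addr0 fv (inj_eq enum_val_inj) eq_sym ji => ->; rewrite scaler0.
rewrite lspan_range; apply/seteqP; split=> _ [c ->].
  by exists (fun i => c (enum_val i)); rewrite (reindex_onto _ _ (fun t _ => enum_rankK t)) /=;
     apply: eq_bigl => i; rewrite enum_valK eqxx.
exists (fun t => c (enum_rank t)).
rewrite [RHS](reindex_onto _ _ (fun t _ => enum_rankK t)) /=.
by apply: eq_big => [i|i _]; rewrite enum_valK ?eqxx.
Qed.

End Families.

Section Increasing.
Variable n : nat.
Definition incr_tuple k := {t : k.-tuple 'I_n | sorted ltn (map val t)}.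
Lemma card_incr k : #|{: incr_tuple k}| = 'C(n, k).
Proof. by rewrite card_sig -card_ltn_sorted_tuples cardsE. Qed.

Definition entry k (t : incr_tuple k) (i : 'I_k) : 'I_n := tnth (val t) i.
Lemma entry_lt k (t : incr_tuple k) (i j : 'I_k) : (i < j)%N -> (entry t i < entry t j)%N.
Proof.
move=> ij; have x0 := entry t i.
rewrite /entry !(tnth_nth x0) -!(nth_map x0 0%N val) ?size_tuple //.
by apply: (sorted_ltn_nth ltn_trans) => //; rewrite ?inE ?size_map ?size_tuple //; exact: (valP t).
Qed.

Lemma incr2_mk (i j : 'I_n) : (i < j)%N ->
  exists t : incr_tuple 2, entry t ord0 = i /\ entry t ord_max = j.
Proof.
move=> ij; have Ht : sorted ltn (map val [tuple i; j]) by rewrite /= ij.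
by exists (exist _ [tuple i; j] Ht).
Qed.

Lemma incr3_mk (i j k : 'I_n) : (i < j)%N -> (j < k)%N ->
  exists t : incr_tuple 3, [/\ entry t ord0 = i,
    entry t (lift ord0 ord0) = j & entry t ord_max = k].
Proof.
move=> ij jk; have Ht : sorted ltn (map val [tuple i; j; k]) by rewrite /= ij jk.
by exists (exist _ [tuple i; j; k] Ht).
Qed.

Lemma incr_inj k (s t : incr_tuple k) : entry s =1 entry t -> s = t.
Proof. by move=> st; apply/val_inj/eq_from_tnth. Qed.

Lemma incr2_eq (s t : incr_tuple 2) :
  (s == t) = (entry s ord0 == entry t ord0) && (entry s ord_max == entry t ord_max).
Proof.
apply/eqP/andP => [->|[/eqP s0 /eqP s1]]; first by rewrite !eqxx.
apply: incr_inj => -[[|[|//]] Hi];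
  [rewrite (_ : Ordinal Hi = ord0)|
   rewrite (_ : Ordinal Hi = ord_max)] => //; exact: val_inj.
Qed.

Lemma incr3_eq (s t : incr_tuple 3) :
  (s == t) = [&& entry s ord0 == entry t ord0,
    entry s (lift ord0 ord0) == entry t (lift ord0 ord0) & entry s ord_max == entry t ord_max].
Proof.
apply/eqP/and3P => [->|[/eqP s0 /eqP s1 /eqP s2]]; first by rewrite !eqxx.
apply: incr_inj => -[[|[|[|//]]] Hi];
  [rewrite (_ : Ordinal Hi = ord0)|rewrite (_ : Ordinal Hi = lift ord0 ord0)|
   rewrite (_ : Ordinal Hi = ord_max)] => //; exact: val_inj.
Qed.

End Increasing.

Lemma bin2_rat n : 'C(n, 2)%:R = n%:R * (n%:R - 1) / 2%:R :> rat.
Proof.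
elim: n => [|n IH]; first by rewrite bin0n !mul0r.
by rewrite binS bin1 natrD IH -natr1; field.
Qed.

Lemma bin3_rat n : 'C(n, 3)%:R = n%:R * (n%:R - 1) * (n%:R - 2%:R) / 6%:R :> rat.
Proof.
elim: n => [|n IH]; first by rewrite bin0n !mul0r.
by rewrite binS natrD IH bin2_rat -natr1; field.
Qed.

(** The 2 by 2 minors of an identity matrix: for increasing pairs the transposed
    product is always zero. *)
Lemma incr2_det (R : pzRingType) n (q p : incr_tuple n 2) :
  (entry q ord0 == entry p ord0)%:R * (entry q ord_max == entry p ord_max)%:R
  - (entry q ord_max == entry p ord0)%:R * (entry q ord0 == entry p ord_max)%:R
  = (q == p)%:R :> R.
Proof.
rewrite incr2_eq -!natrM !mulnb.
suff -> : (entry q ord_max == entry p ord0) && (entry q ord0 == entry p ord_max) = false.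
  by rewrite subr0.
apply/negP => /andP[/eqP qp /eqP pq].
have := entry_lt p (isT : (@ord0 1 < @ord_max 1)%N).
by rewrite -qp -pq ltnNge ltnW // entry_lt.
Qed.

(** The value of the dual form of [s] on [tri] of the basis vectors of [t]. If
    [i] is [b] or [c], then [i], [j], [k] all exceed [a], and each product has a
    factor that compares one of them with [a]. *)
Lemma incr3_det (R : comNzRingType) n (s t : incr_tuple n 3) :
  let i := entry s ord0 in let j := entry s (lift ord0 ord0) in
  let k := entry s ord_max in
  let a := entry t ord0 in let b := entry t (lift ord0 ord0) in
  let c := entry t ord_max in
  (i == a)%:R * ((j == b)%:R * (k == c)%:R - (k == b)%:R * (j == c)%:R)
  + (i == b)%:R * ((j == c)%:R * (k == a)%:R - (k == c)%:R * (j == a)%:R)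
  + (i == c)%:R * ((j == a)%:R * (k == b)%:R - (k == a)%:R * (j == b)%:R)
  = (s == t)%:R :> R.
Proof.
move=> i j k a b c.
rewrite incr3_eq -/i -/j -/k -/a -/b -/c.
have ij : (i < j)%N by apply: entry_lt.
have jk : (j < k)%N by apply: entry_lt.
have ab : (a < b)%N by apply: entry_lt.
have bc : (b < c)%N by apply: entry_lt.
clearbody i j k a b c.
rewrite -!val_eqE /=; move: (nat_of_ord i) (nat_of_ord j) (nat_of_ord k)
  (nat_of_ord a) (nat_of_ord b) (nat_of_ord c) ij jk ab bc => {}i {}j {}k {}a {}b {}c.
move=> ij jk ab bc.
case: (boolP ((i == b) || (i == c))) => [ibc|].
  have [-> [-> ->]] : (i == a) = false /\ (j == a) = false /\ (k == a) = false by lia.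
  by rewrite !(mul0r, mulr0, subr0, addr0).
rewrite negb_or => /andP[/negPf -> /negPf ->].
rewrite !mul0r !addr0 -!natrM !mulnb.
have -> : (k == b) && (j == c) = false by lia.
by rewrite subr0 -natrM mulnb.
Qed.

(** * A basis of the ideal R of the free class 2 algebra *)

Section Basis.
Variables (K : fieldType) (m : nat).
Hypothesis char2 : 2%N \notin [pchar K].
Local Notation g := (free_nilp2 K m).
Local Notation e := (@nilp_gen K m).
Local Notation w := (@chi_w K g).
Local Notation tri := (@chi_tri K g).

Definition pair_br (p : incr_tuple m 2) : g := bracket (e (entry p ord0)) (e (entry p ord_max)).
(** The second part is indexed by increasing pairs of pairs, through the
    enumeration of the increasing pairs. *)
Definition R_basis (t : incr_tuple m 3 + incr_tuple #|{: incr_tuple m 2}| 2) : chi g :=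
  match t with
  | inl t => tri (e (entry t ord0)) (e (entry t (lift ord0 ord0))) (e (entry t ord_max))
  | inr q => w (pair_br (enum_val (entry q ord0))) (pair_br (enum_val (entry q ord_max)))
  end.
Local Notation B := (lspan (range R_basis)).

Let Bs : subspace B. Proof. exact: lspan_subspace. Qed.

Let B_basis t : B (R_basis t). Proof. by apply: lspan_mem; exists t. Qed.

(** Cyclic shifts and transpositions sort the three indices, and a repeated index
    gives zero. *)
Lemma span_tri_gen i j k : B (tri (e i) (e j) (e k)).
Proof.
have lt3 (a b c : 'I_m) : (a < b)%N -> (b < c)%N -> B (tri (e a) (e b) (e c)).
  by move=> ab bc; have [t [<- <- <-]] := incr3_mk ab bc; apply: (B_basis (inl t)).
have lt2 (a b c : 'I_m) : (a < b)%N -> B (tri (e a) (e b) (e c)).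
  move=> ab; case: (ltngtP b c) => [bc|cb|/val_inj <-]; first exact: lt3.
    case: (ltngtP a c) => [ac|ca|/val_inj <-].
    - by rewrite chi_tri_swap chi_tri_cycle; apply: (subspaceN Bs); apply: lt3.
    - by rewrite -chi_tri_cycle; apply: lt3.
    - by rewrite -chi_tri_cycle chi_tri_xx; apply: Bs.1.
  by rewrite chi_tri_cycle chi_tri_xx; apply: Bs.1.
case: (ltngtP i j) => [ij|ji|/val_inj <-]; first exact: lt2.
  by rewrite chi_tri_swap; apply: (subspaceN Bs); apply: lt2.
by rewrite chi_tri_xx; apply: Bs.1.
Qed.

Lemma span_br x y : lspan (range pair_br) (bracket x y).
Proof.
set S := lspan _; have Ss : subspace S by exact: lspan_subspace.
move: x; apply: nilp2_ind.
- split=> [|a u v hu hv]; first by rewrite bracket0l; apply: Ss.1.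
  by rewrite bracket_linearl; apply: Ss.2.
- move=> i; move: y; apply: nilp2_ind.
  + split=> [|a u v hu hv]; first by rewrite bracket0r; apply: Ss.1.
    by rewrite bracket_linearr; apply: Ss.2.
  + move=> j; have lt (a b : 'I_m) : (a < b)%N -> S (bracket (e a) (e b)).
      by move=> /incr2_mk [p [<- <-]]; apply: lspan_mem; exists p.
    case: (ltngtP i j) => [ij|ji|/val_inj <-]; first exact: lt.
      by rewrite bracketC; apply: (subspaceN Ss); apply: lt.
    by rewrite bracketxx; apply: Ss.1.
  + by move=> j k; rewrite nilp2_class2; apply: Ss.1.
- by move=> i j; rewrite bracketC nilp2_class2 oppr0; apply: Ss.1.
Qed.

Lemma span_w_br x y s t : B (w (bracket x y) (bracket s t)).
Proof.
move: (bracket x y) (span_br x y).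
apply: (@lspan_ind _ _ _ [set u | B (w u (bracket s t))]).
  split=> [|a u v hu hv] /=; first by rewrite chi_w0l; apply: Bs.1.
  by rewrite chi_wDl chi_wZl; apply: Bs.2.
move=> _ [p _ <-] /=; move: (bracket s t) (span_br s t).
apply: (@lspan_ind _ _ _ [set u | B (w (pair_br p) u)]).
  split=> [|a u v hu hv] /=; first by rewrite chi_w0r; apply: Bs.1.
  by rewrite chi_wDr chi_wZr; apply: Bs.2.
move=> _ [q _ <-] /=.
have lt a b : (enum_rank a < enum_rank b)%N -> B (w (pair_br a) (pair_br b)).
  move=> /incr2_mk [r [Ha Hb]]; have := B_basis (inr r).
  by rewrite /= Ha Hb !enum_rankK.
case: (ltngtP (enum_rank p) (enum_rank q)) => [pq|qp|/val_inj/enum_rank_inj <-].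
- exact: lt.
- by rewrite chi_wC; apply: (subspaceN Bs); apply: lt.
- by rewrite chi_wxx; apply: Bs.1.
Qed.

(** By trilinearity each argument may be a generator or a bracket of generators;
    a bracket is moved to the first place by a cyclic shift, where [chi_tri_br_l]
    applies. *)
Lemma span_tri x y z : B (tri x y z).
Proof.
have lin b c : subspace [set a | B (tri a b c)].
  split=> [|a u v hu hv] /=; last by rewrite chi_tri_linear; apply: Bs.2.
  by rewrite /chi_tri !(bracket0l, bracket0r, chi_w0l, chi_w0r) !addr0; apply: Bs.1.
have br a b c d : B (tri (bracket a b) c d).
  by rewrite (chi_tri_br_l (@nilp2_class2 K m)); apply: span_w_br.
move: x; apply: (nilp2_ind (lin y z)) => [i|i' j'] /=; last exact: br.
rewrite chi_tri_cycle; move: y; apply: (nilp2_ind (lin z _)) => [j|i' j'] /=; last exact: br.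
rewrite chi_tri_cycle; move: z; apply: (nilp2_ind (lin _ _)) => [k|i' j'] /=; last exact: br.
exact: span_tri_gen.
Qed.

Lemma chiR_span_basis : chiR g = B.
Proof.
rewrite (chiR_tri char2 (@nilp2_class2 K m)); apply/seteqP; split.
  by apply: lspan_ind => // _ [x [y [z ->]]]; apply: span_tri.
apply: lspan_ind; first exact: lspan_subspace.
move=> _ [[t|q] _ <-] /=; apply: lspan_mem; first by do 3 eexists.
by rewrite -(chi_tri_br_l (@nilp2_class2 K m)); do 3 eexists.
Qed.

(** The coordinate of [e_i (x) [e_j, e_k]] detects [tri(e_i, e_j, e_k)], and that
    of [[e_i, e_j] (x) [e_k, e_l]] detects [w([e_i, e_j], [e_k, e_l])]. *)
Definition R_dual (t : incr_tuple m 3 + incr_tuple #|{: incr_tuple m 2}| 2) : chi g -> K :=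
  match t with
  | inl t => wcoef char2 (inl (entry t ord0))
               (inr (entry t (lift ord0 ord0), entry t ord_max))
  | inr q => let p i := enum_val (entry q i) in
      wcoef char2 (inr (entry (p ord0) ord0, entry (p ord0) ord_max))
                  (inr (entry (p ord_max) ord0, entry (p ord_max) ord_max))
  end.
Lemma R_dual_linear t : linear (R_dual t : chi g -> K^o).
Proof. by case: t => ?; apply: wcoef_linear. Qed.

Lemma coord_br_inl x y i : to_coord (bracket x y : g) (inl i) = 0.
Proof. by rewrite (to_coord_hom K m).2. Qed.

Lemma coord_gen_inr i p : to_coord (e i) (inr p) = 0.
Proof. by rewrite to_coord_gen. Qed.

Lemma coord_gen_inl i j : to_coord (e i) (inl j) = (j == i)%:R.
Proof. by rewrite to_coord_gen. Qed.

Lemma coord_br_inr i j k l : to_coord (bracket (e i) (e j)) (inr (k, l)) =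
  (k == i)%:R * (l == j)%:R - (l == i)%:R * (k == j)%:R.
Proof. by rewrite (to_coord_hom K m).2 !to_coord_gen. Qed.

Lemma coord_pair_br p q :
  to_coord (pair_br p) (inr (entry q ord0, entry q ord_max)) = (q == p)%:R.
Proof.
by rewrite coord_br_inr incr2_det.
Qed.

Lemma wcoef_tri p q x y z :
  wcoef char2 p q (tri x y z) = wcoef char2 p q (w x (bracket y z))
   + wcoef char2 p q (w y (bracket z x)) + wcoef char2 p q (w z (bracket x y)).
Proof.
have D u v : wcoef char2 p q (u + v) = wcoef char2 p q u + wcoef char2 p q v.
  by have := wcoef_linear char2 p q 1 u v; rewrite !scale1r.
by rewrite /chi_tri !D.
Qed.

Lemma R_dual_basis s t : R_dual s (R_basis t) = (s == t)%:R.
Proof.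
case: s t => [s|s] [t|t] /=.
- rewrite wcoef_tri !wcoef_w !coord_gen_inl !coord_gen_inr !mul0r !subr0 !coord_br_inr.
  by rewrite incr3_det.
- by rewrite wcoef_w /pair_br !coord_br_inl !(mul0r, mulr0) subr0.
- by rewrite wcoef_tri !wcoef_w !coord_gen_inr !(mul0r, mulr0, subr0, addr0).
by rewrite wcoef_w !coord_pair_br !(inj_eq enum_val_inj) incr2_det.
Qed.

End Basis.

Theorem mainTheorem10 (K : fieldType) (charK : 2%N \notin [pchar K])
    (m : nat) (m_ge1 : (1 <= m)%N) :
  exists d : nat, has_dim (chiR (free_nilp2 K m)) d /\
    d%:R = 1 / 24 * (3 * m%:R ^+ 4 - 2 * m%:R ^+ 3
                     - 15 * m%:R ^+ 2 + 14 * m%:R) :> rat.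
Proof.
exists #|{: incr_tuple m 3 + incr_tuple #|{: incr_tuple m 2}| 2}|; split.
  rewrite (chiR_span_basis m charK); apply: (has_dim_dual (R_dual_linear charK (m:=m))).
  by move=> s t; exact: (R_dual_basis charK s t).
rewrite card_sum !card_incr natrD bin3_rat !bin2_rat.
by field.
Qed.
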